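(* Let $\varepsilon\in\{1,-1\}$ and let $B$ be a finite ring with $2\in B^\times$, having an involution $*$ and a primitive group homomorphism $\beta:B^+\to\mathbb{C}^\times$ such that $\beta(b+\varepsilon b^* )=1$ for all $b\in B$. Let $m\geq1$, with $m$ even if $\varepsilon=1$, and let $T\in\mathrm{GL}(m,B)$. Then $\mu(T)=\mu(T^* )$.
   Context: Rings have identity $1\ne0$ and need not be commutative; an involution is an antiautomorphism of order 1 or 2, extended to $M(m,B)$ by $(x^* )_{ij}=(x_{ji})^*$. $\beta$ is primitive if its kernel contains no right ideal of $B$ other than $(0)$. $B^m$ is the space of column vectors. Let $I\subset B^m\setminus\{0\}$ contain exactly one element of each set $\{v,-v\}$, $0\neq v\in B^m$. For $Y\in\mathrm{GL}(m,B)$ put $I_Y=\{v\in I:Yv\in-I\}$ and $\mu(Y)=(-1)^{|I_Y|}$; $\mu$ is a group homomorphism $\mathrm{GL}(m,B)\to\{1,-1\}$ independent of the choice of $I$. *)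

(* Defs.v *)
From HB Require Import structures.
From mathcomp Require Import all_boot all_order all_algebra.
From mathcomp Require Import reals.
From mathcomp Require Import complex.

Set Implicit Arguments.
Unset Strict Implicit.
Unset Printing Implicit Defensive.

Import Order.TTheory GRing.Theory Num.Theory.
Local Open Scope ring_scope.

Section Involution.

Variable B : finUnitRingType.

Definition ring_involution (star : B -> B) : Prop :=
  [/\ {morph star : x y / x + y},
      {morph star : x y / x * y >-> y * x},
      star 1 = 1
    & involutive star].

Definition star_mx m (star : B -> B) (A : 'M[B]_m) : 'M[B]_m :=
  \matrix_(i, j) star (A j i).

End Involution.

Section PrimitiveCharacter.

Variables (R : realType) (B : finUnitRingType).

(* A group homomorphism from (B, +) to the nonzero complex numbers. *)
Definition additive_character (beta : B -> R[i]) : Prop :=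
  (forall x, beta x != 0) /\ {morph beta : x y / x + y >-> x * y}.

Definition right_ideal (J : {set B}) : Prop :=
  zmod_closed J /\ (forall x b, x \in J -> x * b \in J).

Definition primitive_character (beta : B -> R[i]) : Prop :=
  forall J : {set B},
    right_ideal J -> (forall x, x \in J -> beta x = 1) -> J = [set 0].

End PrimitiveCharacter.

Section Mu.

Variables (B : finUnitRingType) (m : nat).

(* [unitmx] requires a commutative coefficient ring, hence this definition. *)
Definition GL_mx (Y : 'M[B]_m) : Prop :=
  exists Z : 'M[B]_m, Y *m Z = 1%:M /\ Z *m Y = 1%:M.

Definition half_system (I : {set 'cV[B]_m}) : Prop :=
  0 \notin I /\ (forall v, v != 0 -> #|I :&: [set v; - v]| = 1%N).

Definition flipped (I : {set 'cV[B]_m}) (Y : 'M[B]_m) : {set 'cV[B]_m} :=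
  [set v in I | Y *m v \in [set - w | w in I]].

(* The value does not depend on the half system [I] when [Y] is invertible. *)
Definition mu (I : {set 'cV[B]_m}) (Y : 'M[B]_m) : int :=
  (-1) ^+ #|flipped I Y|.

End Mu.

(* Main.v *)
Require Import Defs.
From HB Require Import structures.
From mathcomp Require Import all_boot all_order all_algebra all_fingroup.
From mathcomp Require Import reals.
From mathcomp Require Import complex.

(** By Zolotarev's idea, mu(Y) is the sign of Y as a permutation of the finite
    set B^m: negating the |I_Y| values of Y on I_Y (and hence on -I_Y) is a
    product of |I_Y| transpositions, and the result preserves I and acts in the
    same way on -I, so it is an even permutation ([odd_perm_flips],
    [mu_odd_perm]).

    The map <w, v> := beta (sum_i w_i^* v_i) is a bicharacter on B^m, and it is
    nondegenerate because the right ideal w_i^* B lies in the kernel of beta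
    only if w_i = 0. It satisfies <w, T v> = <T^* w, v>, so the table
    (<w, v>)_(w, v), with its columns permuted by T, is the same table with its
    rows permuted by T^*. Orthogonality of characters makes the table
    invertible; comparing determinants gives T and T^* the same sign
    ([odd_perm_adjoint]). *)

Set Implicit Arguments.
Unset Strict Implicit.
Unset Printing Implicit Defensive.

Import Order.TTheory GRing.Theory Num.Theory.
Local Open Scope ring_scope.

(** * The sign of a permutation commuting with an involution *)

Section SignOfEquivariantPermutation.
Local Open Scope group_scope.

Variables (X : finType) (n : {perm X}) (I : {set X}).
Hypothesis nK : involutive n.
Hypothesis nI : forall v, v \in I -> n v \notin I.

(** Such an [s] is the product of its restriction to [I] and of the conjugate
    of that restriction by [n], which have equal signs. *)
Lemma even_perm_equivariant (s : {perm X}) :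
  (forall v, s (n v) = n (s v)) ->
  (forall v, v \notin I -> n v \notin I -> s v = v) ->
  (forall v, v \in I -> s v \in I) -> odd_perm s = false.
Proof.
move=> sn sfix sI.
have sN : s \in 'N(I | 'P).
  by rewrite inE; apply/andP; split; rewrite inE //; apply/subsetP=> x;
     rewrite inE; apply: sI.
pose p := restr_perm I s.
have pin x : x \in I -> p x = s x by exact: restr_permE.
have pout x : x \notin I -> p x = x by exact: out_perm (restr_perm_on I s).
have -> : s = p * p ^ n.
  apply/permP=> x; rewrite permM.
  have [xI | xI] := boolP (x \in I).
    rewrite pin // -[s x in RHS]nK permJ pout ?nK //.
    exact/nI/sI.
  rewrite pout // -[x in RHS]nK permJ.
  have [nxI | nxI] := boolP (n x \in I); first by rewrite pin // sn nK.
  by rewrite pout // nK sfix.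
by rewrite odd_permM odd_permJ addbb.
Qed.

(** Composing [s] with the transposition of [s v] and [n (s v)] removes a single
    flip [v], changes the sign once, and keeps the commutation with [n] because
    that transposition is its own conjugate by [n]. Once no flip is left,
    [even_perm_equivariant] applies. *)
Lemma odd_perm_flips (s : {perm X}) :
  (forall v, s (n v) = n (s v)) ->
  (forall v, v \notin I -> n v \notin I -> s v = v) ->
  odd_perm s = odd #|[set v in I | n (s v) \in I]|.
Proof.
move Ek: #|_| => k; elim: k s Ek => [|k IHk] s Ek sn sfix.
  apply: even_perm_equivariant => // v vI.
  apply: contraT => svI.
  have nsvI : n (s v) \notin I.
    apply/negP=> nsvI; have : v \in [set u in I | n (s u) \in I].
      by rewrite inE vI.
    by rewrite (cards0_eq Ek) inE.
  by move: (svI); rewrite (perm_inj (sfix _ svI nsvI)) vI.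
have /card_gt0P[v] : (0 < #|[set v in I | n (s v) \in I]|)%N by rewrite Ek.
rewrite inE => /andP[vI nsvI].
have svI : s v \notin I by rewrite -[s v]nK nI.
have svN : s v != n (s v) by apply: contraNneq svI => {1}->.
pose s' := s * tperm (s v) (n (s v)).
have s'E u : u != v -> u != n v -> s' u = s u.
  move=> uv unv; rewrite permM tpermD // eq_sym.
    by rewrite (inj_eq perm_inj).
  by rewrite -sn (inj_eq perm_inj).
have -> : odd_perm s = ~~ odd_perm s'.
  by rewrite odd_permM odd_tperm svN addbT negbK.
rewrite /= (IHk s') //.
- apply/eqP; rewrite -eqSS -Ek (cardsD1 v [set u in I | n (s u) \in I]).
  rewrite inE vI nsvI /= add1n eqSS; apply/eqP/eq_card => u.
  rewrite !inE; have [-> | uv] := eqVneq u v.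
    by rewrite permM tpermL nK (negPf svI) andbF.
  rewrite /=; have [uI | //] := boolP (u \in I).
  by rewrite s'E //; apply: contraTneq uI => ->; exact: nI.
- by move=> u; rewrite !permM sn -[RHS]permJ tpermJ nK tpermC.
- move=> u uI nuI; rewrite s'E ?sfix //.
    by apply: contraNneq uI => ->.
  by apply: contraNneq nuI => ->; rewrite nK.
Qed.

End SignOfEquivariantPermutation.

(** * Permutations of a finite type as permutations of ordinals *)

Section RankPerm.
Local Open Scope group_scope.

Variable X : finType.

Lemma rank_perm_subproof (s : {perm X}) :
  injective (fun i : 'I_#|X| => enum_rank (s (enum_val i))).
Proof. by move=> i j /enum_rank_inj/perm_inj/enum_val_inj. Qed.

(** Permutation matrices are indexed by ordinals: this is how the sign of a
    permutation of [X] becomes a determinant. *)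
Definition rank_perm (s : {perm X}) : 'S_#|X| := perm (@rank_perm_subproof s).

(** Renumbering [X] turns transpositions into transpositions. *)
Lemma odd_rank_perm (s : {perm X}) : odd_perm (rank_perm s) = odd_perm s.
Proof.
have rankM : {morph rank_perm : s t / s * t}.
  by move=> p q; apply/permP=> i; rewrite permM !permE enum_rankK /=.
have rank1 : rank_perm 1 = 1.
  by apply/permP=> i; rewrite !permE enum_valK.
have [ts -> tsD] := prod_tpermP s.
elim: ts tsD => [_ | [x y] ts IH /andP[/= xy tsD]].
  by rewrite big_nil rank1 !odd_perm1.
rewrite big_cons rankM !odd_permM IH // odd_tperm.
suff -> : rank_perm (tperm x y) = tperm (enum_rank x) (enum_rank y).
  by rewrite odd_tperm (inj_eq enum_rank_inj).
apply/permP=> i; rewrite permE; apply: enum_val_inj; rewrite enum_rankK.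
by rewrite (inj_tperm _ _ _ enum_val_inj) !enum_rankK.
Qed.

End RankPerm.

(** * Adjoint permutations for a nondegenerate bicharacter *)

Section Bicharacter.

Variables (F : numFieldType) (A : finZmodType) (K : A -> A -> F).
Hypothesis K_neq0 : forall w v, K w v != 0.
Hypothesis KDl : forall v, {morph K^~ v : w w' / w + w' >-> w * w'}.
Hypothesis KDr : forall w, {morph K w : v v' / v + v' >-> v * v'}.
Hypothesis K_nondeg : forall w, (forall v, K w v = 1) -> w = 0.

(** For [w != 0] some [v] has [K w v != 1]; translating the summation index by
    [v] multiplies the sum by [K w v], so the sum vanishes. *)
Lemma sum_bicharacter w : \sum_v K w v = (#|A| * (w == 0))%:R.
Proof.
have [-> | w0] := eqVneq w 0.
  rewrite muln1 -sum1_card natr_sum; apply: eq_bigr => v _.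
  by apply: (mulIf (K_neq0 0 v)); rewrite -KDl addr0 mul1r.
have [v Kwv | Kw1] := pickP (fun v => K w v != 1); last first.
  by case/eqP: w0; apply: K_nondeg => v; apply/eqP; rewrite -[_ == _]negbK Kw1.
rewrite muln0; apply: (mulfI (x := K w v - 1)); first by rewrite subr_eq0.
rewrite mulr0 mulrBl mul1r mulr_sumr; apply/eqP; rewrite subr_eq0; apply/eqP.
by rewrite [RHS](reindex_inj (addrI v)); apply: eq_bigr => u _; rewrite KDr.
Qed.

Definition bicharacter_table : 'M[F]_#|A| :=
  \matrix_(i, j) K (enum_val i) (enum_val j).

(** Orthogonality of characters: up to the factor [#|A|], the conjugate
    transpose of the table is its inverse. Since the values are roots of unity,
    the conjugate of [K w v] is [K (- w) v], which makes sense over any [F]. *)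
Lemma det_bicharacter_table : \det bicharacter_table != 0.
Proof.
pose L : 'M[F]_#|A| := \matrix_(j, i) K (- enum_val i) (enum_val j).
have KL : bicharacter_table *m L = #|A|%:R%:M.
  apply/matrixP=> i k; rewrite !mxE.
  transitivity (\sum_v K (enum_val i - enum_val k) v).
    rewrite [RHS](reindex _ (onW_bij _ (enum_val_bij A))).
    by apply: eq_bigr => j _; rewrite !mxE KDl.
  rewrite sum_bicharacter subr_eq0 (inj_eq enum_val_inj).
  by case: (i == k); rewrite ?muln1 ?muln0.
have : \det (bicharacter_table *m L) != 0.
  rewrite KL det_scalar expf_neq0 // pnatr_eq0 -lt0n.
  by apply/card_gt0P; exists 0.
by rewrite det_mulmx mulf_eq0 negb_or => /andP[].
Qed.

(** By adjointness, permuting the columns of the table by [s] is the same as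
    permuting its rows by [t]; the two determinants are the determinant of the
    table, which is nonzero, times the signs of [s] and [t]. *)
Lemma odd_perm_adjoint (s t : {perm A}) :
  (forall w v, K w (s v) = K (t w) v) -> odd_perm s = odd_perm t.
Proof.
move=> st.
have : \det (col_perm (rank_perm s) bicharacter_table)
     = \det (row_perm (rank_perm t) bicharacter_table).
  by congr (\det _); apply/matrixP=> i j; rewrite !mxE !permE !enum_rankK.
rewrite col_permE row_permE !det_mulmx !det_perm odd_permV !odd_rank_perm.
rewrite mulrC => /(mulIf det_bicharacter_table)/eqP.
by rewrite (inj_eq signr_inj) => /eqP.
Qed.

End Bicharacter.

(** * The invariant mu as a permutation sign *)

Section MuAsSign.

Variables (B : finUnitRingType) (m : nat).

Lemma GL_mx_inj (Y : 'M[B]_m) :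
  GL_mx Y -> injective (mulmx Y : 'cV[B]_m -> 'cV[B]_m).
Proof.
by case=> Z [_ ZY] u v /(congr1 (mulmx Z)); rewrite !mulmxA ZY !mul1mx.
Qed.

Definition GL_perm (Y : 'M[B]_m) (hY : GL_mx Y) : {perm 'cV[B]_m} :=
  perm (GL_mx_inj hY).

(** A nonzero vector differs from its opposite as 2 is invertible, so [I] and
    [- I] are disjoint and cover everything but 0, which [Y] fixes. *)
Lemma mu_odd_perm (I : {set 'cV[B]_m}) (Y : 'M[B]_m) (hY : GL_mx Y) :
  (2%:R : B) \is a GRing.unit -> half_system I ->
  mu I Y = (-1) ^+ odd_perm (GL_perm hY).
Proof.
move=> u2 [I0 hI].
have opp_neq (v : 'cV[B]_m) : v != 0 -> v != - v.
  apply: contraNneq => vNv; apply/eqP/matrixP=> i j.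
  move/matrixP: vNv => /(_ i j); rewrite !mxE => /eqP.
  rewrite -addr_eq0 -mulr2n -mulr_natl => /eqP h.
  by apply: (mulrI u2); rewrite h mulr0.
have I_or (v : 'cV[B]_m) : v != 0 -> (- v \in I) = (v \notin I).
  move=> v0; have := hI v v0.
  rewrite setIUr cardsU -setIIr.
  have -> : [set v] :&: [set - v] = set0.
    by apply/setP=> x; rewrite !inE; apply/negP=> /andP[/eqP-> /eqP h];
       move: (opp_neq v v0); rewrite -h eqxx.
  have I1 x : #|I :&: [set x]| = (x \in I).
    have [xI | xI] := boolP (x \in I).
      by rewrite (setIidPr _) ?cards1 // sub1set.
    by apply/eqP; rewrite cards_eq0 setIC setI_eq0 disjoints1.
  by rewrite setI0 cards0 subn0 !I1; do 2!case: (_ \in I).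
pose n : {perm 'cV[B]_m} := perm (@oppr_inj 'cV[B]_m).
have nE v : n v = - v by rewrite permE.
rewrite /mu -signr_odd (@odd_perm_flips _ n I).
- congr (_ ^+ nat_of_bool (odd _)); apply: eq_card => v; rewrite !inE nE permE.
  congr (_ && _); apply/imsetP/idP => [[w wI ->] | NYv].
    by rewrite opprK.
  by exists (- (Y *m v)); rewrite ?opprK.
- by move=> v; rewrite !nE opprK.
- move=> v vI; have v0 : v != 0 by apply: contraNneq I0 => <-.
  by rewrite nE I_or // negbK.
- by move=> v; rewrite !nE !permE mulmxN.
- move=> v vI; rewrite nE => NvI.
  have [-> | v0] := eqVneq v 0; first by rewrite permE mulmx0.
  by rewrite I_or // vI in NvI.
Qed.

End MuAsSign.

(** * The pairing attached to an involution and a primitive character *)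

Section HermitianPairing.

Variables (R : realType) (B : finUnitRingType) (star : B -> B).
Variables (beta : B -> R[i]) (m : nat).
Hypothesis hstar : ring_involution star.
Hypothesis hbeta : additive_character beta.
Hypothesis hprim : primitive_character beta.

Lemma star0 : star 0 = 0.
Proof.
by case: hstar => starD _ _ _; apply: (addrI (star 0)); rewrite -starD !addr0.
Qed.

Lemma star_sum (J : Type) (r : seq J) (P : pred J) (f : J -> B) :
  star (\sum_(i <- r | P i) f i) = \sum_(i <- r | P i) star (f i).
Proof.
by case: hstar => starD _ _ _; apply: (big_morph star starD star0).
Qed.

Lemma star_mxM (Y Z : 'M[B]_m) :
  star_mx star (Y *m Z) = star_mx star Z *m star_mx star Y.
Proof.
case: (hstar) => _ starM _ _; apply/matrixP=> i j; rewrite !mxE star_sum.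
by apply: eq_bigr => k _; rewrite starM !mxE.
Qed.

Lemma star_mx1 : star_mx star (1%:M : 'M[B]_m) = 1%:M.
Proof.
case: (hstar) => _ _ star1 _; apply/matrixP=> i j; rewrite !mxE eq_sym.
by case: (i == j); rewrite ?star0.
Qed.

Lemma GL_star_mx (Y : 'M[B]_m) : GL_mx Y -> GL_mx (star_mx star Y).
Proof.
case=> Z [YZ ZY]; exists (star_mx star Z).
by rewrite -!star_mxM YZ ZY star_mx1.
Qed.

(** The character [beta] applied to the standard sesquilinear form [w^* v]. *)
Definition pairing (w v : 'cV[B]_m) : R[i] :=
  beta (\sum_i star (w i 0) * v i 0).

Lemma pairing_neq0 w v : pairing w v != 0.
Proof. by case: hbeta => + _; apply. Qed.

Lemma pairingDl v : {morph pairing^~ v : w w' / w + w' >-> w * w'}.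
Proof.
case: hstar hbeta => starD _ _ _ [_ betaD] w w'; rewrite /pairing -betaD.
rewrite -big_split; congr beta; apply: eq_bigr => i _.
by rewrite mxE starD mulrDl.
Qed.

Lemma pairingDr w : {morph pairing w : v v' / v + v' >-> v * v'}.
Proof.
case: hbeta => _ betaD v v'; rewrite /pairing -betaD.
by rewrite -big_split; congr beta; apply: eq_bigr => i _; rewrite mxE mulrDr.
Qed.

Lemma pairing_adjoint (Y : 'M[B]_m) w v :
  pairing w (Y *m v) = pairing (star_mx star Y *m w) v.
Proof.
case: (hstar) => _ starM _ starK; congr beta.
under eq_bigr do rewrite mxE mulr_sumr.
rewrite exchange_big; apply: eq_bigr => j _; rewrite mxE star_sum mulr_suml.
by apply: eq_bigr => i _; rewrite starM !mxE starK mulrA.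
Qed.

(** Testing [w] against the vectors with a single nonzero entry [b] shows that
    the right ideal generated by [star (w i 0)] lies in the kernel of
    [beta]. *)
Lemma pairing_nondegenerate w : (forall v, pairing w v = 1) -> w = 0.
Proof.
case: (hstar) => _ _ _ starK w1.
apply/matrixP=> i j; rewrite ord1 mxE {j}.
set a := star (w i 0).
pose J := [set a * b | b : B].
have J0 : J = [set 0].
  apply: hprim; first split; first split.
  - by apply/imsetP; exists 0; rewrite ?mulr0.
  - move=> _ _ /imsetP[b _ ->] /imsetP[c _ ->].
    by rewrite -mulrBr imset_f.
  - by move=> _ c /imsetP[b _ ->]; rewrite -mulrA imset_f.
  - move=> _ /imsetP[b _ ->]; rewrite -[RHS](w1 (\col_k (b *+ (k == i)))).
    congr beta; rewrite (bigD1 i) //= mxE eqxx big1 ?addr0 // => k ki.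
    by rewrite mxE (negPf ki) mulr0.
have a0 : a = 0.
  by apply/set1P; rewrite -J0; apply/imsetP; exists 1; rewrite ?mulr1.
by apply: (can_inj starK); rewrite -/a a0 star0.
Qed.

End HermitianPairing.

(** * Invariance of mu under the adjoint *)

Theorem theorem10p2 (R : realType) (eps : int) (B : finUnitRingType)
    (star : B -> B) (beta : B -> R[i]) (m : nat)
    (I : {set 'cV[B]_m}) (T : 'M[B]_m)
    (heps : eps = 1 \/ eps = -1)
    (h2 : (2%:R : B) \is a GRing.unit)
    (hstar : ring_involution star)
    (hbeta : additive_character beta)
    (hprim : primitive_character beta)
    (hbeta_eps : forall b : B, beta (b + star b *~ eps) = 1)
    (hm : (1 <= m)%N)
    (hm_even : eps = 1 -> ~~ odd m)
    (hI : half_system I)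
    (hT : GL_mx T) :
  mu I T = mu I (star_mx star T).
Proof.
rewrite (mu_odd_perm hT) // (mu_odd_perm (GL_star_mx hstar hT)) //.
congr (_ ^+ nat_of_bool _).
apply: (@odd_perm_adjoint R[i] 'cV[B]_m (@pairing R B star beta m)).
- exact: pairing_neq0.
- exact: pairingDl.
- exact: pairingDr.
- exact: pairing_nondegenerate.
- by move=> w v; rewrite !permE; exact: pairing_adjoint.
Qed.
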